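(* Assume that both $f(x,\cdot)$ and $g(x,\cdot)$ are convex for any $x\in X$. Let $\gamma_1,\gamma_2>0$. Then the problem $$(\mathrm{RP})\qquad \min_{(x,y,z)\in X\times Y\times\mathbb{R}^p_+}F(x,y)\quad\text{s.t. }\mathcal{G}_{\gamma}(x,y,z)\le 0$$ is equivalent to the bilevel optimization problem $$(\mathrm{BP})\qquad \min_{x\in X,\,y\in Y}F(x,y)\quad\text{s.t. } y\in S(x),$$ provided that for any feasible point $(x,y)$ of $(\mathrm{BP})$ a corresponding multiplier of the lower-level problem exists at $(x,y)$, i.e. $\mathcal{M}(x,y)\neq\varnothing$.
   Context: $X\subseteq\mathbb{R}^n$ and $Y\subseteq\mathbb{R}^m$ are closed convex sets; $F,f:X\times Y\to\mathbb{R}$ and $g:X\times Y\to\mathbb{R}^p$ are continuously differentiable (convexity of $g(x,\cdot)$ is meant componentwise). $S(x)$ is the set of optimal solutions of the lower-level problem $\min_{y\in Y} f(x,y)$ s.t. $g(x,y)\le 0$. With $\mathcal{L}(x,y,z):=f(x,y)+z^{T}g(x,y)$ and $\gamma=(\gamma_1,\gamma_2)$, $$\mathcal{G}_{\gamma}(x,y,z):=\max_{\theta\in Y,\ \lambda\in\mathbb{R}^p_+}\Big\{\mathcal{L}(x,y,\lambda)-\tfrac{1}{2\gamma_2}\|\lambda-z\|^2-\mathcal{L}(x,\theta,z)-\tfrac{1}{2\gamma_1}\|\theta-y\|^2\Big\}.$$ The set of multipliers at $(x,y)$ is $$\mathcal{M}(x,y):=\{\lambda\in\mathbb{R}^p_+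 : 0\in\nabla_y f(x,y)+\lambda^{T}\nabla_y g(x,y)+\mathcal{N}_Y(y),\ \lambda^{T}g(x,y)=0\},$$ where $\mathcal{N}_Y(y)$ is the normal cone to $Y$ at $y$ and $\lambda^{T}\nabla_y g=\sum_i\lambda_i\nabla_y g_i$. *)

(* Defs.v *)
(* MathComp / MathComp-Analysis *)
From HB Require Import structures.
From mathcomp Require Import all_boot all_order all_algebra.
From mathcomp Require Import all_classical all_reals all_analysis.

Set Implicit Arguments.
Unset Strict Implicit.
Unset Printing Implicit Defensive.

Import Order.TTheory GRing.Theory Num.Theory.
Import numFieldNormedType.Exports.

Local Open Scope classical_set_scope.
Local Open Scope ring_scope.

Section Euclidean.
Context {R : realType} {k : nat}.
Implicit Types u v : 'rV[R]_k.

Definition dot u v : R := \sum_(i < k) u 0 i * v 0 i.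

(* The norm `|_| of 'rV[R]_k is the sup norm; the regularizing terms of the gap
   function use the Euclidean one. *)
Definition sqnorm u : R := dot u u.

Definition orthant : set 'rV[R]_k := [set z | forall i, 0 <= z 0 i].

Definition grad (h : 'rV[R]_k -> R) (y : 'rV[R]_k) : 'rV[R]_k :=
  \row_(j < k) 'D_(delta_mx 0 j) (h : 'rV[R]_k -> R^o) y.

(* Empty at points outside Y. *)
Definition normal_cone (Y : set 'rV[R]_k) (y : 'rV[R]_k) : set 'rV[R]_k :=
  [set v | Y y /\ forall t, Y t -> dot v (t - y) <= 0].

End Euclidean.

(* Continuous differentiability on a closed set A, of a function known through
   an extension to the whole space: C^1 on some open set containing A.  In
   finite dimension, pointwise continuity of q |-> 'd h q v for every v is
   continuity of the differential. *)
Definition C1_on {R : realType} {V W : normedModType R} (A : set V)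
    (h : V -> W) : Prop :=
  exists U : set V, [/\ open U, A `<=` U &
    forall q, U q ->
      differentiable h q /\
      forall v : V, {for q, continuous (fun q' : V => 'd h q' v)}].

Section Problems.
Context {R : realType}.

(* min J over A *)
Definition solutions {T : Type} (A : set T) (J : T -> R) : set T :=
  [set a | A a /\ forall b, A b -> J a <= J b].

Definition optimal_value {T : Type} (A : set T) (J : T -> R) : \bar R :=
  ereal_inf [set (J a)%:E | a in A].

(* Equivalence of (min K over B), which has auxiliary variables forgotten by
   pi, with (min J over A): same feasible points, same value, and a feasible
   point of the former is optimal iff its projection is optimal for the
   latter.  The first and third items give
   pi @` solutions B K = solutions A J. *)
Definition equivalent_problems {T U : Type} (pi : U -> T)
    (B : set U) (K : U -> R) (A : set T) (J : T -> R) : Prop :=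
  [/\ pi @` B = A,
      optimal_value B K = optimal_value A J &
      forall u, B u -> (solutions B K u <-> solutions A J (pi u))].

End Problems.

Section Bilevel.
Context {R : realType} {n m p : nat}.
Variables (X : set 'rV[R]_n) (Y : set 'rV[R]_m).
Variables (f : 'rV[R]_n -> 'rV[R]_m -> R)
          (g : 'rV[R]_n -> 'rV[R]_m -> 'rV[R]_p).

Definition lower_solutions (x : 'rV[R]_n) : set 'rV[R]_m :=
  solutions [set y | Y y /\ forall i, g x y 0 i <= 0] (f x).

Definition lagrangian (x : 'rV[R]_n) (y : 'rV[R]_m) (z : 'rV[R]_p) : R :=
  f x y + dot z (g x y).

(* The maximum is rendered as a supremum in \bar R, which needs no attainment
   argument to be meaningful and equals the maximum whenever it is attained. *)
Definition gap (gamma1 gamma2 : R)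
    (x : 'rV[R]_n) (y : 'rV[R]_m) (z : 'rV[R]_p) : \bar R :=
  ereal_sup [set (lagrangian x y w.2 - (2 * gamma2)^-1 * sqnorm (w.2 - z)
                  - lagrangian x w.1 z
                  - (2 * gamma1)^-1 * sqnorm (w.1 - y))%:E
            | w in Y `*` orthant].

Definition multipliers (x : 'rV[R]_n) (y : 'rV[R]_m) : set 'rV[R]_p :=
  [set l | [/\ orthant l,
     exists2 v, normal_cone Y y v &
       0 = grad (f x) y + \sum_(i < p) l 0 i *: grad (fun t => g x t 0 i) y + v
   & dot l (g x y) = 0]].

Definition BP_feasible : set ('rV[R]_n * 'rV[R]_m) :=
  [set q | [/\ X q.1, Y q.2 & lower_solutions q.1 q.2]].

Definition RP_feasible (gamma1 gamma2 : R) :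
    set ('rV[R]_n * 'rV[R]_m * 'rV[R]_p) :=
  [set w | [/\ X w.1.1, Y w.1.2, orthant w.2 &
               (gap gamma1 gamma2 w.1.1 w.1.2 w.2 <= 0)%E]].

End Bilevel.

(* Main.v *)
(* The gap splits into a part in lambda and a part in theta, and at lambda = z,
   theta = y both vanish; so it is nonpositive iff y and z are optimal in two
   proximally regularized convex problems.  A point which is optimal for a
   convex problem up to a quadratic error centred at that point is optimal
   exactly: move a fraction s towards a competitor, which gains order s and
   costs order s^2.  Hence a nonpositive gap makes (y, z) a saddle point of the
   Lagrangian, so that y solves the lower-level problem.  Conversely a multiplier
   z at a solution y makes (y, z) a saddle point, by the gradient inequality. *)
Require Import Defs.
From HB Require Import structures.
From mathcomp Require Import all_boot all_order all_algebra.
From mathcomp Require Import all_classical all_reals all_analysis.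
From mathcomp Require Import ring lra.

Set Implicit Arguments.
Unset Strict Implicit.
Unset Printing Implicit Defensive.

Import Order.TTheory GRing.Theory Num.Theory.
Import numFieldNormedType.Exports.

Local Open Scope classical_set_scope.
Local Open Scope ring_scope.

(** * Inner product and convexity along segments *)

Section ConvexAnalysis.
Context {R : realType} {k : nat}.
Implicit Types (A : set 'rV[R]_k) (h : 'rV[R]_k -> R) (u v x y : 'rV[R]_k).

Lemma dotDl u v y : dot (u + v) y = dot u y + dot v y.
Proof.
by rewrite /dot -big_split; apply: eq_bigr => i _; rewrite mxE mulrDl.
Qed.

Lemma dotZl (a : R) u y : dot (a *: u) y = a * dot u y.
Proof. by rewrite /dot mulr_sumr; apply: eq_bigr => i _; rewrite mxE mulrA. Qed.

Lemma dot0l y : dot 0 y = 0.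
Proof. by rewrite -(scale0r 0) dotZl mul0r. Qed.

Lemma dot_suml (I : finType) (u : I -> 'rV[R]_k) y :
  dot (\sum_i u i) y = \sum_i dot (u i) y.
Proof.
apply: (big_morph (fun w => dot w y)) => [v w|]; [exact: dotDl|exact: dot0l].
Qed.

Lemma dotC u v : dot u v = dot v u.
Proof. by apply: eq_bigr => i _; rewrite mulrC. Qed.

Lemma dot_orthant_le0 u v : orthant u -> (forall i, v 0 i <= 0) ->
  dot u v <= 0.
Proof.
by move=> u0 v0; apply: sumr_le0 => i _; rewrite mulr_ge0_le0.
Qed.

Lemma dot_delta (i : 'I_k) y : dot (delta_mx 0 i) y = y 0 i.
Proof.
rewrite /dot (bigD1 i)//= big1 => [|j ji]; first by rewrite mxE !eqxx mul1r addr0.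
by rewrite mxE (negbTE ji) andbF mul0r.
Qed.

Lemma sqnorm_ge0 u : 0 <= sqnorm u.
Proof. by apply: sumr_ge0 => i _; rewrite -expr2 sqr_ge0. Qed.

Lemma sqnorm0 : sqnorm (0 : 'rV[R]_k) = 0.
Proof. exact: dot0l. Qed.

Lemma sqnormZ (a : R) u : sqnorm (a *: u) = a ^+ 2 * sqnorm u.
Proof.
rewrite /sqnorm /dot mulr_sumr; apply: eq_bigr => i _.
by rewrite !mxE mulrACA.
Qed.

(** [conv t y x] puts the weight [t] on its first argument, hence the swapped order. *)
Lemma convex_segmentE (x y : convex_lmodType 'rV[R]_k) (t : {i01 R}) :
  conv t y x = x + t%:num *: (y - x) :> 'rV[R]_k.
Proof.
change (t%:num *: (y : 'rV[R]_k) + (1 - t%:num) *: (x : 'rV[R]_k) =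
  x + t%:num *: (y - x)).
by rewrite scalerBl scale1r scalerBr addrCA.
Qed.

Lemma convex_set_segment A x y (t : R) : convex_set A -> A x -> A y ->
  0 <= t -> t <= 1 -> A (x + t *: (y - x)).
Proof.
move=> cA Ax Ay t0 t1; rewrite -(convex_segmentE x y (Itv01 t0 t1)).
by apply/set_mem/cA; rewrite inE.
Qed.

Lemma convex_function_segment A h x y (t : R) : convex_function A h ->
  A x -> A y -> 0 <= t -> t <= 1 ->
  h (x + t *: (y - x)) <= h x + t * (h y - h x).
Proof.
move=> ch Ax Ay t0 t1.
have := ch (Itv01 t0 t1) y x; rewrite !inE => /(_ Ay Ax).
rewrite convex_segmentE convRE/= => /le_trans; apply.
by rewrite mulrBl mul1r addrCA mulrBr.
Qed.

Lemma minimum_of_quadratic_error A h (c : R) y : convex_set A -> convex_function A h ->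
  0 <= c -> A y -> (forall t, A t -> h y - h t <= c * sqnorm (t - y)) ->
  forall t, A t -> h y <= h t.
Proof.
move=> cA ch c0 Ay hy t At; rewrite leNgt; apply/negP => hty.
pose a := h y - h t; pose b := c * sqnorm (t - y).
have a0 : 0 < a by rewrite subr_gt0.
have b0 : 0 <= b by rewrite mulr_ge0// sqnorm_ge0.
have ab0 : 0 < a + b by rewrite ltr_wpDr.
(* The gain s a must not exceed the cost s^2 b, which fails for this s. *)
pose s := a / (a + b).
have s0 : 0 < s by rewrite divr_gt0.
have s1 : s <= 1 by rewrite ler_pdivrMr// mul1r lerDl.
have := hy _ (convex_set_segment cA Ay At (ltW s0) s1).
rewrite [X in sqnorm X](_ : _ = s *: (t - y)) ?sqnormZ; last by rewrite addrC addKr.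
have := convex_function_segment ch Ay At (ltW s0) s1.
have -> : h t - h y = - a by rewrite opprB.
move=> h1 h2.
have : s * a <= s * (s * b).
  by rewrite mulrA -expr2; rewrite /b in h2 *; lra.
rewrite ler_pM2l// /s mulrAC ler_pdivlMr// mulrDr => h3.
have := mulr_gt0 a0 a0; lra.
Qed.

(** Convexity bounds the difference quotients for [t] in ]0, 1] by [h y - h x], and the bound passes
    to the limit from the right. *)
Lemma convex_derive_le A h x y : convex_function A h -> A x -> A y ->
  derivable (h : _ -> R^o) x (y - x) ->
  'D_(y - x) (h : _ -> R^o) x <= h y - h x.
Proof.
move=> ch Ax Ay dh.
apply: (cvgr_to_le (cvg_dnbhs_at_right dh)).
near=> t => /=.
  have t0 : 0 < t by [].
  have t1 : t <= 1 by near: t; exact: nbhs_right_ltW.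
  have := convex_function_segment ch Ax Ay (ltW t0) t1.
  by rewrite /GRing.scale/= ler_pdivrMl// lerBlDl [_ *: _ + x]addrC.
Unshelve. all: by end_near. Qed.

Lemma derive_grad h y v : differentiable (h : _ -> R^o) y ->
  'D_v (h : _ -> R^o) y = dot v (grad h y).
Proof.
move=> dh; rewrite deriveE//.
rewrite {1}(row_sum_delta v) linear_sum; apply: eq_bigr => i _.
by rewrite linearZ mxE deriveE.
Qed.

Lemma convex_grad_le A h x y : convex_function A h -> A x -> A y ->
  differentiable (h : _ -> R^o) x ->
  dot (y - x) (grad h x) <= h y - h x.
Proof.
move=> ch Ax Ay dh; rewrite -derive_grad//.
by apply: (convex_derive_le ch) => //; exact: diff_derivable.
Qed.

End ConvexAnalysis.

Lemma convex_orthant (R : realType) (k : nat) :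
  convex_set (@orthant R k).
Proof.
move=> x y t; rewrite !inE => x0 y0 i.
rewrite convex_segmentE !mxE.
have -> : y 0 i + t%:num * (x 0 i - y 0 i) =
  t%:num * x 0 i + (1 - t%:num) * y 0 i by ring.
by rewrite addr_ge0// mulr_ge0// subr_ge0 le1.
Qed.

(** The sign turns maximization over multipliers into minimization of a convex function. *)
Lemma convex_dotN (R : realType) (k : nat) (A : set 'rV[R]_k) (c : 'rV[R]_k) :
  convex_function A (fun l => - dot l c).
Proof.
move=> t x y _ _; rewrite convex_segmentE convRE dotDl dotZl dotDl.
rewrite -scaleN1r dotZl /unstable.onem; lra.
Qed.

(** * The Lagrangian at a multiplier *)

Section Lagrangian.
Context {R : realType} {n m p : nat}.
Variables (X : set 'rV[R]_n) (Y : set 'rV[R]_m).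
Variables (f : 'rV[R]_n -> 'rV[R]_m -> R)
          (g : 'rV[R]_n -> 'rV[R]_m -> 'rV[R]_p).

(** A slice is the joint map composed with [t => (x, t)]; the open set in [C1_on] takes care of
    boundary points. *)
Lemma C1_on_differentiable_r (W : normedModType R)
    (h : 'rV[R]_n -> 'rV[R]_m -> W) x y :
  C1_on (X `*` Y) (fun q => h q.1 q.2) -> X x -> Y y ->
  differentiable (h x) y.
Proof.
move=> [U [_ XYU dU]] Xx Yy.
have [dh _] := dU (x, y) (XYU (x, y) (conj Xx Yy)).
apply: (differentiable_comp (f := fun t => (x, t))
  (g := fun q => h q.1 q.2)) => //.
Qed.

Lemma convex_lagrangian x z :
  convex_function Y (f x) ->
  (forall i, convex_function Y (fun y => g x y 0 i)) ->
  orthant z -> convex_function Y (fun y => lagrangian f g x y z).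
Proof.
move=> cf cg z0 t u v Yu Yv; have := cf t u v Yu Yv.
rewrite !convRE /lagrangian => hf.
have hg : dot z (g x (conv t u v)) <=
    t%:num * dot z (g x u) + (unstable.onem t%:num) * dot z (g x v).
  rewrite /dot !mulr_sumr -big_split ler_sum// => i _.
  have := cg i t u v Yu Yv; rewrite convRE => /(ler_wpM2l (z0 i)) /le_trans; apply.
  by rewrite mulrDr !mulrA ![z 0 i * _]mulrC.
rewrite !mulrDr addrACA; exact: lerD.
Qed.

(** By stationarity the gradient of the Lagrangian in [y] is [- v], so the gradient inequalities,
    weighted by [z 0 i >= 0], bound its increment below by [- dot v (t - y) >= 0]. *)
Lemma multiplier_lagrangian_min x y z :
  convex_function Y (f x) -> differentiable (f x : _ -> R^o) y ->
  (forall i, convex_function Y (fun y => g x y 0 i)) ->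
  differentiable (g x) y ->
  multipliers Y f g x y z ->
  forall t, Y t -> lagrangian f g x y z <= lagrangian f g x t z.
Proof.
move=> cf df cg dg [z0 [v [Yy vN] stat] _] t Yt.
have hf := convex_grad_le cf Yy Yt df.
have hg i : dot (t - y) (grad (fun t => g x t 0 i) y) <= g x t 0 i - g x y 0 i.
  apply: (convex_grad_le (cg i)) => //.
  exact: (differentiable_comp dg (differentiable_coord _ 0 i)).
have hv := vN t Yt.
have := congr1 (dot^~ (t - y)) stat; rewrite dot0l !dotDl dot_suml => stat'.
have : \sum_i dot (z 0 i *: grad (fun t => g x t 0 i) y) (t - y) <=
    dot z (g x t) - dot z (g x y).
  rewrite /dot -sumrB ler_sum// => i _; rewrite -/(dot _ _) -mulrBr dotZl.
  by rewrite ler_wpM2l// dotC.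
rewrite dotC in hf.
rewrite /lagrangian; lra.
Qed.

(** * Nonpositive gap and lower-level optimality *)

Variables gamma1 gamma2 : R.
Hypotheses (gamma1_gt0 : 0 < gamma1) (gamma2_gt0 : 0 < gamma2).

(** The quadratic terms stand alone on the right, as the error in [minimum_of_quadratic_error]. *)
Lemma gap_le0P x y z : (gap Y f g gamma1 gamma2 x y z <= 0)%E <->
  forall t l, Y t -> orthant l ->
  lagrangian f g x y l - lagrangian f g x t z <=
  (2 * gamma2)^-1 * sqnorm (l - z) + (2 * gamma1)^-1 * sqnorm (t - y).
Proof.
split=> [gap0 t l Yt l0|H].
  have := le_trans (ereal_sup_ubound (imageP _ (conj Yt l0 : (Y `*` orthant) (t, l)))) gap0.
  by rewrite lee_fin/=; lra.
apply: ge_ereal_sup => _ [[t l] [/= Yt l0] <-].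
by rewrite lee_fin; have := H t l Yt l0; lra.
Qed.

Lemma gap_le0_lower_solutions x y z : convex_set Y ->
  convex_function Y (f x) ->
  (forall i, convex_function Y (fun y => g x y 0 i)) ->
  Y y -> orthant z -> (gap Y f g gamma1 gamma2 x y z <= 0)%E ->
  lower_solutions Y f g x y.
Proof.
move=> cY cf cg Yy z0 /gap_le0P gap0.
(* Taking [t = y] leaves only the linear problem in the multiplier. *)
have hl l : orthant l -> dot l (g x y) <= dot z (g x y).
  rewrite -lerN2.
  apply: (minimum_of_quadratic_error (c := (2 * gamma2)^-1) (@convex_orthant _ _)
    (convex_dotN (g x y))) => // [|l' l'0].
    by rewrite invr_ge0 mulr_ge0 ?ltW.
  by have := gap0 y l' Yy l'0; rewrite /lagrangian subrr sqnorm0; lra.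
(* Taking [l = z] leaves only the problem in [t]. *)
have ht t : Y t -> lagrangian f g x y z <= lagrangian f g x t z.
  apply: (minimum_of_quadratic_error (c := (2 * gamma1)^-1) cY
    (convex_lagrangian cf cg z0)) => // [|t' Yt'].
    by rewrite invr_ge0 mulr_ge0 ?ltW.
  by have := gap0 t' z Yt' z0; rewrite subrr sqnorm0; lra.
(* Raising the coordinate [i] of [z] by 1 adds exactly [g x y 0 i] to the maximal value
   [dot z (g x y)]. *)
have gy0 i : g x y 0 i <= 0.
  have : orthant (z + delta_mx 0 i).
    by move=> j; rewrite !mxE addr_ge0.
  by move/hl; rewrite dotDl dot_delta; lra.
(* The competitor here is [l = 0]. *)
have zg0 : 0 <= dot z (g x y).
  by rewrite -(dot0l (g x y)); apply: hl => i; rewrite mxE.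
(* With L the Lagrangian, f(x,y) <= L(x,y,z) <= L(x,t,z) <= f(x,t). *)
split=> // t [Yt gt0]; have := ht t Yt.
have : dot z (g x t) <= 0 by exact: dot_orthant_le0.
rewrite /lagrangian; lra.
Qed.

(** Feasibility and complementarity give L(x,y,l) <= f(x,y) = L(x,y,z) <= L(x,t,z), and the
    quadratic terms are nonnegative. *)
Lemma lagrangian_min_gap_le0 x y z :
  (forall i, g x y 0 i <= 0) -> dot z (g x y) = 0 ->
  (forall t, Y t -> lagrangian f g x y z <= lagrangian f g x t z) ->
  (gap Y f g gamma1 gamma2 x y z <= 0)%E.
Proof.
move=> gy0 zg zmin; apply/gap_le0P => t l Yt l0.
have := zmin t Yt; have h2 := dot_orthant_le0 l0 gy0.
have h3 : 0 <= (2 * gamma2)^-1 * sqnorm (l - z).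
  by rewrite mulr_ge0 ?sqnorm_ge0// invr_ge0 mulr_ge0 ?ltW.
have h4 : 0 <= (2 * gamma1)^-1 * sqnorm (t - y).
  by rewrite mulr_ge0 ?sqnorm_ge0// invr_ge0 mulr_ge0 ?ltW.
by rewrite /lagrangian zg; lra.
Qed.

End Lagrangian.

(** * Forgetting the auxiliary variable *)

(** The objective depends on [u] only through [pi u], so it takes the same values over [B] as [J]
    over the image. *)
Lemma equivalent_problems_image (R : realType) (T U : Type) (pi : U -> T)
    (B : set U) (A : set T) (J : T -> R) :
  pi @` B = A -> equivalent_problems pi B (J \o pi) A J.
Proof.
move=> <-; split=> // [|u Bu].
  by rewrite /optimal_value image_comp.
split=> [[_ umin]|[_ umin]].
  by split; [exists u|move=> _ [v Bv <-]; exact: umin].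
by split=> // v Bv; apply: umin; exists v.
Qed.

Theorem theorem2p3 (R : realType) (n m p : nat)
  (X : set 'rV[R]_n) (Y : set 'rV[R]_m)
  (F f : 'rV[R]_n -> 'rV[R]_m -> R)
  (g : 'rV[R]_n -> 'rV[R]_m -> 'rV[R]_p)
  (gamma1 gamma2 : R)
  (closedX : closed X) (convexX : convex_set X)
  (closedY : closed Y) (convexY : convex_set Y)
  (C1F : C1_on (X `*` Y) (fun q => F q.1 q.2 : R^o))
  (C1f : C1_on (X `*` Y) (fun q => f q.1 q.2 : R^o))
  (C1g : C1_on (X `*` Y) (fun q => g q.1 q.2))
  (convexf : forall x, X x -> convex_function Y (f x))
  (convexg : forall x, X x -> forall i : 'I_p,
     convex_function Y (fun y => g x y 0 i))
  (gamma1_gt0 : 0 < gamma1) (gamma2_gt0 : 0 < gamma2)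
  (has_multiplier : forall x y, BP_feasible X Y f g (x, y) ->
     multipliers Y f g x y !=set0) :
  equivalent_problems (fun w : 'rV[R]_n * 'rV[R]_m * 'rV[R]_p => w.1)
    (RP_feasible X Y f g gamma1 gamma2) (fun w => F w.1.1 w.1.2)
    (BP_feasible X Y f g) (fun q => F q.1 q.2).
Proof.
apply: (equivalent_problems_image (fun q => F q.1 q.2)).
apply/seteqP; split=> [_ [[[x y] z] [/= Xx Yy z0 gap0] <-]|[x y] xyBP].
  split=> //=; exact: (gap_le0_lower_solutions gamma1_gt0 gamma2_gt0 convexY
    (convexf x Xx) (convexg x Xx) Yy z0 gap0).
have [z zM] := has_multiplier _ _ xyBP.
have [/= Xx Yy [[_ gy0] _]] := xyBP.
have [z0 _ zg] := zM.
(* The multiplier itself serves as the auxiliary variable. *)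
exists (x, y, z) => //; split=> //=.
apply: (lagrangian_min_gap_le0 gamma1_gt0 gamma2_gt0 gy0 zg).
apply: (multiplier_lagrangian_min (convexf x Xx) _ (convexg x Xx) _ zM).
- exact: (C1_on_differentiable_r C1f Xx Yy).
- exact: (C1_on_differentiable_r C1g Xx Yy).
Qed.
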